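(* Let $m\ge 1$, let $A,B$ be real $m\times m$ matrices and $c\in\mathbb{R}^m$ satisfying the standing assumptions (S1)–(S5) listed in the context, and let $\rho=|d^{(1)}|/X_{\mathrm{fp}}^{(1)}>0$. For $\mu\in\mathbb{R}$ and $\delta\neq 0$ with $\operatorname{sign}\delta=\operatorname{sign} d^{(1)}$, let $y_{\mathrm{upper}}(\mu,\delta)$, $y_{\mathrm{lower}}(\mu,\delta)$ be the two points of the period-two response to alternate pacing described in the context, and let $$\Gamma=\Gamma(\mu,\delta)=\frac{y_{\mathrm{upper}}^{(1)}(\mu,\delta)-y_{\mathrm{lower}}^{(1)}(\mu,\delta)}{2|\delta|}.$$ Then there are positive constants $\Gamma_{\mathrm{const}}$ and $\gamma$ (independent of $\mu$ and $\delta$) such that, for all $\mu\ge 0$ and all such $\delta\neq0$, $$\Gamma=\begin{cases}\Gamma_{\mathrm{const}}, & \text{if } \mu\ge\rho|\delta|,\\[2pt] \Gamma_{\mathrm{const}}+\gamma\left(\rho-\dfrac{\mu}{|\delta|}\right), & \text{if } \mu\le\rho|\delta|.\end{cases}$$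
   Context: For $x\in\mathbb{R}^m$, $x^{(1)}$ denotes the first component of $x$; $\lambda_i(M)$ denote the (complex) eigenvalues of a matrix $M$. The unperturbed map is $x_{n+1}=Ax_n+\mu c$ if $x_n^{(1)}\ge0$, $x_{n+1}=Bx_n+\mu c$ if $x_n^{(1)}\le 0$, where $\mu\in\mathbb{R}$ is a bifurcation parameter. Standing assumptions: (S1) (continuity) $Ax=Bx$ for every $x$ with $x^{(1)}=0$. (S2) All eigenvalues of $A$ satisfy $|\lambda_i(A)|<1$, and $X_{\mathrm{fp}}:=(I-A)^{-1}c$ satisfies $X_{\mathrm{fp}}^{(1)}>0$. Put $x_{\mathrm{fp}}(\mu)=\mu X_{\mathrm{fp}}$. (S3) $I-B$ is invertible, the first component of $(I-B)^{-1}c$ is positive, and at least one eigenvalue of $B$ satisfies $|\lambda_i(B)|>1$. (S4) All eigenvalues of $AB$ satisfy $|\lambda_i(AB)|<1$, and the vectors $X_{\mathrm{upper}}:=(I-BA)^{-1}(I+B)c$, $X_{\mathrm{lower}}:=(I-AB)^{-1}(I+A)c$ satisfy $X_{\mathrm{upper}}^{(1)}<0$ and $X_{\mathrm{lower}}^{(1)}>0$. Put $x_{\mathrm{upper}}(\mu)=\mu X_{\mathrm{upper}}$, $x_{\mathrm{lower}}(\mu)=\mu X_{\mathrm{lower}}$. (S5) $d:=(I+A)^{-1}c$ satisfies $d^{(1)}\neq0$. Alternate pacing: the map with perturbed parameter is $$x_{n+1}=\begin{cases}Ax_n+[\mu+(-1)^n\delta]c, & x_n^{(1)}\ge0,\\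 Bx_n+[\mu+(-1)^n\delta]c,& x_n^{(1)}\le0.\end{cases}$$ The sign convention $\operatorname{sign}\delta=\operatorname{sign}d^{(1)}$ is adopted (so $\delta\ne0$). Set $\mu_{\mathrm{crit}}(\delta)=\rho|\delta|$. The response considered is the period-two solution of the paced map with $x_n=y_{\mathrm{upper}}(\mu,\delta)$ for $n$ odd and $x_n=y_{\mathrm{lower}}(\mu,\delta)$ for $n$ even, given as follows. - For $\mu\ge\mu_{\mathrm{crit}}(\delta)$ (unilateral solution, $y_{\mathrm{upper}}^{(1)}>y_{\mathrm{lower}}^{(1)}\ge0$): it solves $y_{\mathrm{upper}}=Ay_{\mathrm{lower}}+(\mu+\delta)c$, $y_{\mathrm{lower}}=Ay_{\mathrm{upper}}+(\mu-\delta)c$, i.e. $y_{\mathrm{upper}}=x_{\mathrm{fp}}(\mu)+\delta d$, $y_{\mathrm{lower}}=x_{\mathrm{fp}}(\mu)-\delta d$. - For $\mu\le\mu_{\mathrm{crit}}(\delta)$ (bilateral solution, $y_{\mathrm{upper}}^{(1)}>0\ge y_{\mathrm{lower}}^{(1)}$): it solves $y_{\mathrm{upper}}=By_{\mathrm{lower}}+(\mu+\delta)c$, $y_{\mathrm{lower}}=Ay_{\mathrm{upper}}+(\mu-\delta)c$, i.e. $y_{\mathrm{upper}}=x_{\mathrm{upper}}(\mu)+\delta s_{\mathrm{upper}}$, $y_{\mathrm{lower}}=x_{\mathrm{lower}}(\mu)-\delta s_{\mathrm{lower}}$, where $s_{\mathrm{upper}}=(I-BA)^{-1}(I-B)c$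 and $s_{\mathrm{lower}}=(I-AB)^{-1}(I-A)c$. The two descriptions agree at $\mu=\mu_{\mathrm{crit}}(\delta)$. *)

(* Defs.v *)
From mathcomp Require Import all_boot all_order all_algebra.
From mathcomp Require Import reals.
From mathcomp Require Import complex.

Set Implicit Arguments.
Unset Strict Implicit.
Unset Printing Implicit Defensive.

Import Order.TTheory GRing.Theory Num.Theory.
Local Open Scope ring_scope.

(* [z] is an eigenvalue, possibly non-real, of the real matrix [M]. *)
Definition ceigenvalue (R : realType) (m : nat) (M : 'M[R]_m) (z : complex R)
    : bool :=
  eigenvalue (map_mx (real_complex R) M) z.

(* The dimension is [m.+1] below, so that every vector has a first component. *)
Definition first (R : realType) (m : nat) (x : 'cV[R]_m.+1) : R := x ord0 ord0.

Section Vectors.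
Variables (R : realType) (m : nat) (A B : 'M[R]_m.+1) (c : 'cV[R]_m.+1).

Definition Xfp : 'cV[R]_m.+1 := invmx (1%:M - A) *m c.

Definition Xupper : 'cV[R]_m.+1 := invmx (1%:M - B *m A) *m ((1%:M + B) *m c).

Definition Xlower : 'cV[R]_m.+1 := invmx (1%:M - A *m B) *m ((1%:M + A) *m c).

Definition dvec : 'cV[R]_m.+1 := invmx (1%:M + A) *m c.

Definition rho : R := `|first dvec| / first Xfp.

Definition mu_crit (delta : R) : R := rho * `|delta|.

(* The matrices inverted in [Xfp], [Xupper], [Xlower] and [dvec] are invertible
   by the spectral conditions on [A] and [A *m B]; [1%:M - B] is not covered by
   them, whence [hB_unit]. *)
Record standing_assumptions : Prop := StandingAssumptions {
  hcontinuity : forall x : 'cV[R]_m.+1, first x = 0 -> A *m x = B *m x;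
  hA_stable : forall z : complex R, ceigenvalue A z -> `|z| < 1;
  hXfp_gt0 : 0 < first Xfp;
  hB_unit : 1%:M - B \in unitmx;
  hB_fp_gt0 : 0 < first (invmx (1%:M - B) *m c);
  hB_unstable : exists2 z : complex R, ceigenvalue B z & 1 < `|z|;
  hAB_stable : forall z : complex R, ceigenvalue (A *m B) z -> `|z| < 1;
  hXupper_lt0 : first Xupper < 0;
  hXlower_gt0 : 0 < first Xlower;
  hd_neq0 : first dvec != 0
}.

(* [x'] is the image of [x] under the map at step [n] of alternate pacing; both
   branches are imposed when the first component of [x] vanishes. *)
Definition paced_step (mu delta : R) (n : nat) (x x' : 'cV[R]_m.+1) : Prop :=
  (0 <= first x -> x' = A *m x + (mu + (-1) ^+ n * delta) *: c) /\
  (first x <= 0 -> x' = B *m x + (mu + (-1) ^+ n * delta) *: c).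

Definition paced_orbit (mu delta : R) (x : nat -> 'cV[R]_m.+1) : Prop :=
  forall n : nat, paced_step mu delta n (x n) (x n.+1).

(* The sign conditions select the unilateral solution for
   [mu_crit delta <= mu] and the bilateral one for [mu <= mu_crit delta]. *)
Definition pacing_response (mu delta : R) (yupper ylower : 'cV[R]_m.+1)
    : Prop :=
  [/\ paced_orbit mu delta (fun n => if odd n then yupper else ylower),
      mu_crit delta <= mu -> 0 <= first ylower < first yupper
    & mu <= mu_crit delta -> first ylower <= 0 < first yupper].

End Vectors.

Definition gain (R : realType) (m : nat) (delta : R)
    (yupper ylower : 'cV[R]_m.+1) : R :=
  (first yupper - first ylower) / (2 * `|delta|).

(* Main.v *)
(* For fixed [delta] both two-cycles are affine in [mu]. At
   [mu = rho * `|delta|] the lower point of the unilateral cycle has first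
   component 0, so by continuity of the map this cycle is also bilateral, and
   uniqueness makes the two branches meet there. The difference of the first
   components does not depend on [mu] on the unilateral branch, and has slope
   [first Xupper - first Xlower < 0] on the bilateral one. *)

Require Import Defs.
From mathcomp Require Import all_boot all_order all_algebra.
From mathcomp Require Import reals.
From mathcomp Require Import complex ring.

Set Implicit Arguments.
Unset Strict Implicit.
Unset Printing Implicit Defensive.

Import Order.TTheory GRing.Theory Num.Theory.
Local Open Scope ring_scope.

(** * Invertibility criteria and affine two-cycles *)

Lemma stable_unitmx (R : realType) (n : nat) (M : 'M[R]_n) (a : R) :
  (forall z : complex R, ceigenvalue M z -> `|z| < 1) -> 1 <= `|a| ->
  a%:M - M \in unitmx.
Proof.
(* If [a%:M - M] were singular, the real number [a] would be an eigenvalue of the complexified [M],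
   hence of modulus below 1. *)
move=> stM a1; apply: contraLR (a1) => nu; rewrite -ltNge.
have /stM : ceigenvalue M (real_complex R a).
  rewrite /ceigenvalue /eigenvalue /eigenspace kermx_eq0 row_free_unit.
  by rewrite -map_scalar_mx -map_mxB map_unitmx -opprB -scaleN1r
             unitmxZ ?unitrN1.
by rewrite normc_def /= expr0n addr0 sqrtr_sqr -(rmorph1 (real_complex R)) ltcR.
Qed.

(** Sylvester's trick: with [X] the inverse of [1 - Q P], the inverse of [1 - P Q] is explicitly
    [1 + P X Q]. *)
Lemma unitmx_sub1_mulC (R : comUnitRingType) (n : nat) (P Q : 'M[R]_n) :
  1%:M - Q *m P \in unitmx -> 1%:M - P *m Q \in unitmx.
Proof.
move=> u; set X := invmx (1%:M - Q *m P).
have XE : X - Q *m P *m X = 1%:M.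
  by rewrite -[X in X - _]mul1mx -mulmxBl mulmxV.
suff : (1%:M - P *m Q) *m (1%:M + P *m X *m Q) = 1%:M by case/mulmx1_unit.
have -> : (1%:M - P *m Q) *m (1%:M + P *m X *m Q) =
    1%:M - P *m Q + P *m (X - Q *m P *m X) *m Q.
  by rewrite mulmxDr mulmx1 !(mulmxBl, mulmxBr) mul1mx !mulmxA.
by rewrite XE mulmx1 subrK.
Qed.

(** Eliminating one point from [u = P l + a], [l = Q u + b] gives closed forms for [u] and [l]. They
    satisfy the first equation; exchanging the roles of [P] and [Q] yields the second. *)
Lemma two_cycle_exists (R : comUnitRingType) (n : nat) (P Q : 'M[R]_n)
    (a b : 'cV[R]_n) :
  1%:M - Q *m P \in unitmx ->
  invmx (1%:M - P *m Q) *m (P *m b + a) =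
  P *m (invmx (1%:M - Q *m P) *m (Q *m a + b)) + a.
Proof.
move=> uQP; have uPQ := unitmx_sub1_mulC uQP.
apply: (canLR (mulKmx uPQ)); set l := invmx _ *m _.
have lE : l - Q *m P *m l = Q *m a + b.
  by rewrite -[X in X - _]mul1mx -mulmxBl mulKVmx.
have -> : (1%:M - P *m Q) *m (P *m l + a) =
    P *m (l - Q *m P *m l) + (a - P *m Q *m a).
  by rewrite mulmxDr !mulmxBl !mul1mx mulmxBr !mulmxA.
by rewrite lE mulmxDr mulmxA (addrC (P *m Q *m a)) addrACA subrr addr0.
Qed.

(** The forcings cancel in differences, so [l - l'] is fixed by [Q P] and vanishes. *)
Lemma two_cycle_unique (R : comUnitRingType) (n : nat) (P Q : 'M[R]_n)
    (a b u l u' l' : 'cV[R]_n) :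
  1%:M - Q *m P \in unitmx ->
  u = P *m l + a -> l = Q *m u + b -> u' = P *m l' + a -> l' = Q *m u' + b ->
  u = u' /\ l = l'.
Proof.
move=> uQP uE lE u'E l'E; suff ll : l = l' by rewrite uE u'E ll.
apply/eqP; rewrite -subr_eq0; apply/eqP; rewrite -(mulKmx uQP (l - l')).
suff -> : (1%:M - Q *m P) *m (l - l') = 0 by rewrite mulmx0.
rewrite mulmxBl mul1mx -mulmxA mulmxBr.
have -> : P *m l - P *m l' = u - u' by rewrite uE u'E opprD addrACA subrr addr0.
by rewrite mulmxBr lE l'E (opprD (Q *m u')) addrACA subrr addr0 subrr.
Qed.

(** Superposition of a response to the constant forcing [c] and one to the alternating forcing,
    whose sign at the current step is [e]. *)
Lemma two_cycle_affine (R : comUnitRingType) (n : nat) (P : 'M[R]_n)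
    (c x y s t : 'cV[R]_n) (e mu delta : R) :
  x = P *m y + c -> s = P *m t + e *: c ->
  mu *: x + delta *: s = P *m (mu *: y + delta *: t) + (mu + e * delta) *: c.
Proof.
move=> xE sE; rewrite {1}xE {1}sE mulmxDr -!scalemxAr !scalerDr scalerDl.
by rewrite scalerA (mulrC delta) addrACA.
Qed.

Lemma first_lin (R : realType) (m : nat) (a b : R) (x y : 'cV[R]_m.+1) :
  first (a *: x + b *: y) = a * first x + b * first y.
Proof. by rewrite /first !mxE. Qed.

Lemma firstN (R : realType) (m : nat) (x : 'cV[R]_m.+1) :
  first (- x) = - first x.
Proof. by rewrite /first mxE. Qed.

Lemma paced_orbit2P (R : realType) (m : nat) (A B : 'M[R]_m.+1)
    (c yu yl : 'cV[R]_m.+1) (mu delta : R) :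
  paced_orbit A B c mu delta (fun n => if odd n then yu else yl) <->
  paced_step A B c mu delta 0 yl yu /\ paced_step A B c mu delta 1 yu yl.
Proof.
split=> [orb | [s0 s1] n]; first by split; [exact: orb 0%N | exact: orb 1%N].
rewrite /paced_step /= -signr_odd.
by case: (odd n) => /=; [exact: s1 | exact: s0].
Qed.

(** * The unilateral and bilateral cycles of the paced map *)

Section PacingResponse.
Variables (R : realType) (m : nat) (A B : 'M[R]_m.+1) (c : 'cV[R]_m.+1).
Hypothesis hyp : standing_assumptions A B c.

(** Sensitivities of the bilateral cycle to [delta]: its upper point moves by [supper], its lower
    point by [- slower]. *)
Let supper : 'cV[R]_m.+1 := invmx (1%:M - B *m A) *m ((1%:M - B) *m c).
Let slower : 'cV[R]_m.+1 := invmx (1%:M - A *m B) *m ((1%:M - A) *m c).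

Let fp : 'cV[R]_m.+1 := Xfp A c.
Let d : 'cV[R]_m.+1 := dvec A c.

Let unit_I_subA : 1%:M - A \in unitmx.
Proof. by apply: stable_unitmx (hA_stable hyp) _; rewrite normr1. Qed.

Let unit_I_addA : 1%:M + A \in unitmx.
Proof.
have := @stable_unitmx R _ A (-1) (hA_stable hyp).
rewrite normrN1 lexx => /(_ isT); rewrite raddfN /= -opprD -scaleN1r.
by rewrite unitmxZ ?unitrN1.
Qed.

(** Both half-steps of the unilateral cycle use [A], so its uniqueness rests on this matrix. *)
Let unit_I_subAA : 1%:M - A *m A \in unitmx.
Proof.
suff -> : 1%:M - A *m A = (1%:M - A) *m (1%:M + A).
  by rewrite unitmx_mul unit_I_subA.
by rewrite mulmxDr mulmx1 mulmxBl mul1mx addrA subrK.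
Qed.

Let unit_I_subAB : 1%:M - A *m B \in unitmx.
Proof. by apply: stable_unitmx (hAB_stable hyp) _; rewrite normr1. Qed.

Let fpE : fp = A *m fp + c.
Proof.
have : (1%:M - A) *m fp = c by rewrite mulKVmx.
by rewrite mulmxBl mul1mx => <-; rewrite addrC subrK.
Qed.

(** Under [A] with forcing alternating between [c] and [- c], the points [d] and [- d] form a
    two-cycle. *)
Let dE : d = A *m (- d) + 1 *: c.
Proof.
have : (1%:M + A) *m d = c by rewrite mulKVmx.
by rewrite mulmxDl mul1mx scale1r mulmxN => <-; rewrite addrCA addNr addr0.
Qed.

Let NdE : - d = A *m d + (-1) *: c.
Proof. by rewrite {1}dE opprD mulmxN opprK scaleN1r scale1r. Qed.

Let XupperE : Xupper A B c = B *m Xlower A B c + c.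
Proof.
rewrite /Xupper /Xlower !mulmxDl !mul1mx !(addrC c).
exact: two_cycle_exists.
Qed.

Let XlowerE : Xlower A B c = A *m Xupper A B c + c.
Proof.
rewrite /Xupper /Xlower !mulmxDl !mul1mx !(addrC c).
exact/two_cycle_exists/unitmx_sub1_mulC.
Qed.

(** With the minus sign, this is the closed form of the lower point of the two-cycle forced by [c]
    and then [- c]. *)
Let NslowerE :
  - slower = invmx (1%:M - A *m B) *m (A *m c + (-1) *: c).
Proof. by rewrite /slower -mulmxN mulmxBl mul1mx opprB scaleN1r. Qed.

Let supper_unfold :
  supper = invmx (1%:M - B *m A) *m (B *m ((-1) *: c) + c).
Proof. by rewrite /supper mulmxBl mul1mx scaleN1r mulmxN (addrC c). Qed.

Let supperE : supper = B *m (- slower) + 1 *: c.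
Proof. by rewrite NslowerE supper_unfold scale1r; exact: two_cycle_exists. Qed.

Let slowerE : - slower = A *m supper + (-1) *: c.
Proof.
by rewrite NslowerE supper_unfold; exact/two_cycle_exists/unitmx_sub1_mulC.
Qed.

Let uni_upper mu delta := mu *: fp + delta *: d.
Let uni_lower mu delta := mu *: fp + delta *: (- d).
Let bi_upper mu delta := mu *: Xupper A B c + delta *: supper.
Let bi_lower mu delta := mu *: Xlower A B c + delta *: (- slower).

Let uni_upperE mu delta :
  uni_upper mu delta = A *m uni_lower mu delta + (mu + 1 * delta) *: c.
Proof. exact: two_cycle_affine. Qed.

Let uni_lowerE mu delta :
  uni_lower mu delta = A *m uni_upper mu delta + (mu + (-1) * delta) *: c.
Proof. exact: two_cycle_affine. Qed.

Let bi_upperE mu delta :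
  bi_upper mu delta = B *m bi_lower mu delta + (mu + 1 * delta) *: c.
Proof. exact: two_cycle_affine. Qed.

Let bi_lowerE mu delta :
  bi_lower mu delta = A *m bi_upper mu delta + (mu + (-1) * delta) *: c.
Proof. exact: two_cycle_affine. Qed.

(** * The critical value of [mu] and the identification of the response *)

Let first_uni_lower mu delta :
  first (uni_lower mu delta) = mu * first fp - delta * first d.
Proof. by rewrite first_lin firstN mulrN. Qed.

Let first_uni_upper mu delta :
  first (uni_upper mu delta) = mu * first fp + delta * first d.
Proof. exact: first_lin. Qed.

Let mu_critE delta : mu_crit A c delta * first fp = `|delta| * `|first d|.
Proof.
by rewrite /mu_crit /rho mulrAC divfK ?gt_eqF ?(hXfp_gt0 hyp) // mulrC.
Qed.

Let crit_bi_uni delta : delta * first d = `|delta| * `|first d| ->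
  bi_upper (mu_crit A c delta) delta = uni_upper (mu_crit A c delta) delta /\
  bi_lower (mu_crit A c delta) delta = uni_lower (mu_crit A c delta) delta.
Proof.
move=> dd; set mu := mu_crit A c delta.
have l0 : first (uni_lower mu delta) = 0.
  by rewrite first_uni_lower dd mu_critE subrr.
apply: (two_cycle_unique unit_I_subAB (bi_upperE _ _) (bi_lowerE _ _) _
  (uni_lowerE _ _)).
(* The lower unilateral point lies on the switching plane, where [A] and [B] act alike. *)
by rewrite -(hcontinuity hyp l0) -uni_upperE.
Qed.

(** Lets the bilateral cycle be measured from [mu_crit], where it coincides with the unilateral
    one. *)
Let bi_shift mu mu' delta :
  first (bi_upper mu delta) =
    first (bi_upper mu' delta) + (mu - mu') * first (Xupper A B c) /\
  first (bi_lower mu delta) =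
    first (bi_lower mu' delta) + (mu - mu') * first (Xlower A B c).
Proof. by rewrite !first_lin; split; ring. Qed.

Let response_unilateral mu delta yu yl : mu_crit A c delta <= mu ->
  pacing_response A B c mu delta yu yl ->
  yu = uni_upper mu delta /\ yl = uni_lower mu delta.
Proof.
move=> le_mu [/paced_orbit2P[s0 s1] /(_ le_mu) /andP[yl0 ylu] _].
apply: (two_cycle_unique unit_I_subAA (s0.1 _) (s1.1 _) (uni_upperE _ _)
  (uni_lowerE _ _)) => //; exact: le_trans (ltW ylu).
Qed.

Let response_bilateral mu delta yu yl : mu <= mu_crit A c delta ->
  pacing_response A B c mu delta yu yl ->
  yu = bi_upper mu delta /\ yl = bi_lower mu delta.
Proof.
move=> le_mu [/paced_orbit2P[s0 s1] _ /(_ le_mu) /andP[yl0 yu0]].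
by apply: (two_cycle_unique unit_I_subAB (s0.2 _) (s1.1 _) (bi_upperE _ _)
  (bi_lowerE _ _)) => //; exact: ltW.
Qed.

Lemma pacing_response_gain (mu delta : R) :
  delta != 0 -> Num.sg delta = Num.sg (first d) ->
  (exists yu yl, pacing_response A B c mu delta yu yl) /\
  (forall yu yl, pacing_response A B c mu delta yu yl ->
     (rho A c * `|delta| <= mu -> gain delta yu yl = `|first d|) /\
     (mu <= rho A c * `|delta| ->
        gain delta yu yl =
          `|first d| + (first (Xlower A B c) - first (Xupper A B c)) / 2
                       * (rho A c - mu / `|delta|))).
Proof.
move=> delta0 sgE.
(* The sign convention makes this product positive. *)
have dd : delta * first d = `|delta| * `|first d|.
  by rewrite [delta in LHS]numEsg [first d in LHS]numEsg sgE mulrACA -expr2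
     sqr_sg (hd_neq0 hyp) mul1r.
have adelta0 : 0 < `|delta| by rewrite normr_gt0.
have ad0 : 0 < `|first d| by rewrite normr_gt0 (hd_neq0 hyp).
have fp0 : 0 < first fp := hXfp_gt0 hyp.
have critE := mu_critE delta.
have [buE blE] := crit_bi_uni dd.
have [bu bl] := bi_shift mu (mu_crit A c delta) delta.
(* At [mu_crit] the first components are [2 * |delta| * |first d|] above and 0 below; the bilateral
   ones differ from these by multiples of [mu - mu_crit]. *)
rewrite buE first_uni_upper critE dd in bu.
rewrite blE first_uni_lower critE dd subrr add0r in bl.
split.
  have [le_mu | lt_mu] := leP (mu_crit A c delta) mu.
    exists (uni_upper mu delta), (uni_lower mu delta).
    have yl0 : 0 <= first (uni_lower mu delta).
      by rewrite first_uni_lower dd -critE subr_ge0 ler_wpM2r // ltW.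
    have yu0 : first (uni_lower mu delta) < first (uni_upper mu delta).
      rewrite first_uni_lower first_uni_upper dd.
      by rewrite ltrD2l gtrN // mulr_gt0.
    have yu_gt0 := le_lt_trans yl0 yu0.
    split; [apply/paced_orbit2P; split; split | by rewrite yl0 | ].
    - by move=> _; exact: uni_upperE.
    (* Here the lower point is on the switching plane, so the [B] branch is imposed as well and
       follows from continuity. *)
    - move=> yl_le0; rewrite -(hcontinuity hyp) -?uni_upperE //.
      by apply/le_anti; rewrite yl0 yl_le0.
    - by move=> _; exact: uni_lowerE.
    - by rewrite leNgt yu_gt0.
    - move=> ge_mu; rewrite yu_gt0 andbT first_uni_lower dd -critE.
      by rewrite subr_le0 ler_wpM2r // ltW.
  exists (bi_upper mu delta), (bi_lower mu delta).
  (* Now [mu - mu_crit] is negative: multiplied by [first Xlower > 0] it pushes the lower point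
     below 0, multiplied by [first Xupper < 0] it raises the upper one. *)
  have yl0 : first (bi_lower mu delta) < 0.
    by rewrite bl pmulr_llt0 ?subr_lt0 // (hXlower_gt0 hyp).
  have yu0 : 0 < first (bi_upper mu delta).
    rewrite bu; apply: addr_gt0; first by rewrite addr_gt0 ?mulr_gt0.
    by rewrite nmulr_rgt0 ?subr_lt0 // (hXupper_lt0 hyp).
  split; [apply/paced_orbit2P; split; split | by rewrite leNgt lt_mu | ].
  - by rewrite leNgt yl0.
  - by move=> _; exact: bi_upperE.
  - by move=> _; exact: bi_lowerE.
  - by rewrite leNgt yu0.
  - by rewrite yu0 (ltW yl0).
move=> yu yl resp; split=> le_mu.
  have [-> ->] := response_unilateral le_mu resp.
  (* The [mu] terms cancel, leaving a difference of [2 * |delta| * |first d|]. *)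
  rewrite /gain first_uni_upper first_uni_lower dd.
  by field; rewrite gt_eqF.
have [-> ->] := response_bilateral le_mu resp.
rewrite /gain bu bl /mu_crit.
by field; rewrite gt_eqF.
Qed.

End PacingResponse.

Theorem theorem4p1 (R : realType) (m : nat) (A B : 'M[R]_m.+1)
    (c : 'cV[R]_m.+1) (hyp : standing_assumptions A B c) :
  exists Gamma_const gamma : R,
    [/\ 0 < Gamma_const, 0 < gamma &
      forall mu delta : R, 0 <= mu -> delta != 0 ->
        Num.sg delta = Num.sg (first (dvec A c)) ->
        (exists yupper ylower : 'cV[R]_m.+1,
           pacing_response A B c mu delta yupper ylower) /\
        (forall yupper ylower : 'cV[R]_m.+1,
           pacing_response A B c mu delta yupper ylower ->
           (rho A c * `|delta| <= mu ->
              gain delta yupper ylower = Gamma_const) /\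
           (mu <= rho A c * `|delta| ->
              gain delta yupper ylower =
                Gamma_const + gamma * (rho A c - mu / `|delta|)))].
Proof.
exists `|first (dvec A c)|.
(* The bilateral slope in [mu] with its sign reversed; the factor 1/2 comes from the denominator
   [2 * |delta|] of the gain. *)
exists ((first (Xlower A B c) - first (Xupper A B c)) / 2); split.
- by rewrite normr_gt0 (hd_neq0 hyp).
- rewrite divr_gt0 // subr_gt0.
  exact: lt_trans (hXupper_lt0 hyp) (hXlower_gt0 hyp).
- by move=> mu delta _; exact: pacing_response_gain.
Qed.
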